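(* Let $a\in\mathbb{N}$, let $b$ be a non-negative integer, let $u_n=an+b$ for $n\in\mathbb{N}$, and let $\mathcal{A}=\{u_n:n\in\mathbb{N}\}$. Suppose that one of the following conditions holds: (a) $\psi\in\mathcal{D}_1$; (b) $\psi\in\mathcal{D}_2$ and $\psi'(u_n)/\psi(n)\to0$ as $n\to\infty$. Then $\operatorname{d}_\psi(\mathcal{A})=1/a$.
   Context: $\mathbb{N}=\{1,2,3,\dots\}$ and $\chi_A$ is the characteristic function of a set $A\subset\mathbb{N}$. $\mathcal{D}$ denotes the class of strictly increasing, differentiable, unbounded functions $\psi:(0,\infty)\to(0,\infty)$. $\mathcal{D}_1$ is the class of all concave functions in $\mathcal{D}$. $\mathcal{D}_2$ is the class of all convex functions $\psi\in\mathcal{D}$ that satisfy $\psi(n+1)/\psi(n)\to1$ as $n\to\infty$ through the positive integers. For $\psi\in\mathcal{D}$ and $A\subset\mathbb{N}$, the $\psi$-density of $A$ is $$\operatorname{d}_\psi(A)=\lim_{n\to\infty}\frac{\sum_{k=1}^n\psi'(k)\chi_A(k)}{\sum_{k=1}^n\psi'(k)}$$ when the limit exists; the assertion $\operatorname{d}_\psi(\mathcal{A})=1/a$ includes the existence of the limit. *)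

(* Defs.v *)
From mathcomp Require Import all_boot all_order all_algebra.
From mathcomp Require Import all_classical all_reals all_analysis.

Set Implicit Arguments.
Unset Strict Implicit.
Unset Printing Implicit Defensive.

Import Order.TTheory GRing.Theory Num.Theory.
Import numFieldNormedType.Exports.

Local Open Scope classical_set_scope.
Local Open Scope ring_scope.

(* A function (0, oo) -> (0, oo) is represented by a total psi : R -> R that is
   constrained only on the open half-line; its values at x <= 0 are irrelevant,
   also to the derivative at points x > 0. *)
Record class_D (R : realType) (psi : R -> R) : Prop := ClassD {
  class_D_gt0 : {in `]0, +oo[, forall x, 0 < psi x} ;
  class_D_increasing : {in `]0, +oo[ &, {homo psi : x y / x < y}} ;
  class_D_derivable : {in `]0, +oo[, forall x, derivable psi x 1} ;
  class_D_unbounded : ~ [bounded psi x | x in `]0, +oo[%classic] }.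

Record class_D1 (R : realType) (psi : R -> R) : Prop := ClassD1 {
  class_D1_D : class_D psi ;
  class_D1_concave :
    convex_function (`]0, +oo[%classic : set R^o) (fun x => - psi x) }.

Record class_D2 (R : realType) (psi : R -> R) : Prop := ClassD2 {
  class_D2_D : class_D psi ;
  class_D2_convex : convex_function (`]0, +oo[%classic : set R^o) psi ;
  class_D2_ratio : psi n.+1%:R / psi n%:R @[n --> \oo] --> (1 : R) }.

(* The limit defining d_psi(A) exists and equals l.  Since the sums start at
   k = 1, A is read as a subset of {1, 2, ...}. *)
Definition has_psi_density (R : realType) (psi : R -> R) (A : set nat)
    (l : R) : Prop :=
  (\sum_(1 <= k < n.+1) derive1 psi k%:R * \1_A k)
    / (\sum_(1 <= k < n.+1) derive1 psi k%:R) @[n --> \oo] --> l.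

Definition arith_prog (a b n : nat) : nat := (a * n + b)%N.

Definition arith_prog_set (a b : nat) : set nat :=
  arith_prog a b @` [set n | (0 < n)%N].

(* Main.v *)
Require Import Defs.
From mathcomp Require Import all_boot all_order all_algebra.
From mathcomp Require Import all_classical all_reals all_analysis.
From mathcomp Require Import ring lra zify.

(** The set A of the terms a n + b occupies a proportion 1/a of the integers so
    evenly that the sums of a * 1_A - 1 over 1, ..., n stay bounded, uniformly
    in n ([arith_prog_discrepancy]).  Summation by parts transfers such a bound
    C to sums weighted by w k = psi' k: as w is nonnegative and monotone, its
    total variation over 1, ..., n is at most w 1 + w n, and hence
      |a * sum_(k <= n) w k 1_A k - sum_(k <= n) w k| <= C (w 1 + 2 w n)
    ([bounded_discrepancy_sum_le]).  After division by W n = sum_(k <= n) w k,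
    the density is 1/a as soon as W n --> +oo and w n / W n --> 0
    ([weighted_density_of_bounded_discrepancy]).

    Everything about w comes from the tangent line inequality, which compares
    psi' with the increments of psi: for concave psi, w decreases and
    psi (k+1) - psi k <= w k; for convex psi, w increases and
    psi (k+1) - psi k <= w (k+1).  Both give psi n - psi 1 <= W n, so W can be
    replaced by the unbounded function psi: it remains to see that
    w n / psi n --> 0.  In the concave case w n <= w 1.  In the convex case
    w n <= psi' (a n + b) because n <= a n + b, and the ratio
    psi' (a n + b) / psi n vanishes at infinity by assumption. *)

Import Order.TTheory GRing.Theory Num.Theory.
Import numFieldNormedType.Exports.
Local Open Scope classical_set_scope.
Local Open Scope ring_scope.

(** * Sums of bounded discrepancy against a monotone weight *)

Lemma abel_summation {R : comNzRingType} (w e : nat -> R) (n : nat) :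
  \sum_(1 <= k < n.+1) w k * e k =
  w n * \sum_(1 <= k < n.+1) e k
  - \sum_(1 <= k < n) (w k.+1 - w k) * \sum_(1 <= j < k.+1) e j.
Proof.
elim: n => [|[|n] IH].
- by rewrite !big_geq// mulr0 subr0.
- by rewrite !big_nat1 (@big_geq _ _ _ 1 1)// subr0.
- rewrite (big_nat_recr n.+2)//= IH [in RHS](@big_nat_recr _ _ _ n.+1 1)//=.
  rewrite (big_nat_recr n.+2 1 e)//=; ring.
Qed.

(** Only the values at positive integers are constrained: the weights of
    interest are values at k of a function on the open half-line. *)
Definition monotone_pos {R : numDomainType} (w : nat -> R) : Prop :=
  (forall k, (0 < k)%N -> w k <= w k.+1) \/
  (forall k, (0 < k)%N -> w k.+1 <= w k).

(** The sum telescopes to |w n - w 1|. *)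
Lemma total_variation_le {R : realDomainType} {w : nat -> R} {n : nat} :
  (forall k, (0 < k)%N -> 0 <= w k) -> monotone_pos w -> (0 < n)%N ->
  \sum_(1 <= k < n) `|w k.+1 - w k| <= w 1%N + w n.
Proof.
move=> w0 [wi|wd] n0.
- rewrite (@telescope_sumr_eq _ _ _ w)//; last first.
    by move=> k /andP[k0 _]; rewrite ger0_norm// subr_ge0 wi.
  by have := w0 1%N isT; lra.
- rewrite (@telescope_sumr_eq _ _ _ (fun k => - w k))//; last first.
    by move=> k /andP[k0 _]; rewrite ler0_norm ?subr_le0 ?wd//; ring.
  by have := w0 n n0; lra.
Qed.

(** In the summation by parts every partial sum of [e] is at most [C], so what
    is left is [w n] and the total variation of [w]. *)
Lemma bounded_discrepancy_sum_le {R : realDomainType} (w e : nat -> R) (C : R)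
    (n : nat) :
  (forall k, (0 < k)%N -> 0 <= w k) -> monotone_pos w -> (0 < n)%N ->
  (forall m, `|\sum_(1 <= k < m.+1) e k| <= C) ->
  `|\sum_(1 <= k < n.+1) w k * e k| <= C * (w 1%N + w n *+ 2).
Proof.
move=> w0 wm n0 eC; rewrite abel_summation (le_trans (ler_normB _ _))//.
have C0 : 0 <= C := le_trans (normr_ge0 _) (eC 0%N).
have -> : C * (w 1%N + w n *+ 2) = w n * C + (w 1%N + w n) * C by ring.
apply: lerD; first by rewrite normrM (ger0_norm (w0 _ n0)) ler_wpM2l ?w0.
rewrite (le_trans _ (ler_wpM2r C0 (total_variation_le w0 wm n0)))//.
rewrite (le_trans (ler_norm_sum _ _ _))// mulr_suml ler_sum// => k _.
by rewrite normrM ler_wpM2l.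
Qed.

(** With e = a * 1_A - 1, the quotient to be studied is (1 + r n) / a where
    r n = (sum_(k <= n) w k * e k) / W n, and r n is squeezed to 0 by the bound
    C (w 1 + 2 w n) / W n. *)
Lemma weighted_density_of_bounded_discrepancy {R : realType} (w : nat -> R)
    (A : set nat) (a C : R) :
  0 < a ->
  (forall k, (0 < k)%N -> 0 <= w k) -> monotone_pos w ->
  \sum_(1 <= k < n.+1) w k @[n --> \oo] --> +oo ->
  w n / \sum_(1 <= k < n.+1) w k @[n --> \oo] --> (0 : R) ->
  (forall m, `|\sum_(1 <= k < m.+1) (a * \1_A k - 1)| <= C) ->
  (\sum_(1 <= k < n.+1) w k * \1_A k)
    / (\sum_(1 <= k < n.+1) w k) @[n --> \oo] --> a^-1.
Proof.
move=> a0 w0 wm; set W := fun n => \sum_(1 <= k < n.+1) w k.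
rewrite -/(W _) => Woo wW eC.
have W0 : \forall n \near \oo, 0 < W n by move/cvgryPgt : Woo; apply.
set r := fun n => (\sum_(1 <= k < n.+1) w k * (a * \1_A k - 1)) / W n.
have r0 : r n @[n --> \oo] --> (0 : R).
  apply/norm_cvg0P.
  apply: (@squeeze_cvgr _ _ _ _ (fun=> 0) (fun n =>
    C * (w 1%N * (W n)^-1 + (w n / W n) *+ 2))); last 2 first.
  - exact: cvg_cst.
  - rewrite -[X in _ --> X](_ : C * (w 1%N * 0 + 0 *+ 2) = 0); last by ring.
    apply: cvgMl_tmp; apply: cvgD; last exact: cvgMn.
    by apply: cvgMl_tmp; apply/gtr0_cvgV0.
  near=> n; rewrite normr_ge0/= /r normrM normfV.
  have Wn : 0 < W n by near: n.
  rewrite (gtr0_norm Wn) ler_pdivrMr//.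
  rewrite (_ : _ * W n = C * (w 1%N + w n *+ 2)); last first.
    by field; rewrite gt_eqF.
  by apply: bounded_discrepancy_sum_le => //; near: n; exact: nbhs_infty_gt.
have -> : a^-1 = a^-1 * (1 + 0) by rewrite addr0 mulr1.
apply: (@cvg_trans _ (a^-1 * (1 + r n) @[n --> \oo])); last first.
  by apply: cvgMl_tmp; apply: cvgD => //; exact: cvg_cst.
apply: near_eq_cvg; near=> n.
have Wn : 0 < W n by near: n.
rewrite /r.
have -> : \sum_(1 <= k < n.+1) w k * (a * \1_A k - 1) =
    a * (\sum_(1 <= k < n.+1) w k * \1_A k) - W n.
  by rewrite mulr_sumr /W -sumrB; apply: eq_bigr => k _; ring.
by rewrite /W in Wn *; field; rewrite !gt_eqF.
Unshelve. all: by end_near.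
Qed.

(** * The discrepancy of an arithmetic progression *)

Lemma mem_arith_prog_setS (a b n : nat) : (0 < a)%N ->
  (n.+1 \in arith_prog_set a b) = (b <= n)%N && (a %| n.+1 - b)%N.
Proof.
move=> a0; apply/idP/idP.
  rewrite inE => -[m /= m0]; rewrite /arith_prog => e; apply/andP; split; first nia.
  by rewrite (_ : (n.+1 - b)%N = (a * m)%N) ?dvdn_mulr//; lia.
move=> /andP[bn /dvdnP[m e]]; rewrite inE.
exists m => /=; rewrite ?/arith_prog; nia.
Qed.

(** Both sides grow by one exactly when n + 1 is in the progression; while
    n < b the truncated subtraction keeps the right-hand side at 0. *)
Lemma arith_prog_count {R : nzRingType} (a b n : nat) : (0 < a)%N ->
  \sum_(1 <= k < n.+1) (\1_(arith_prog_set a b) k : R) = ((n - b) %/ a)%:R.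
Proof.
move=> a0; elim: n => [|n IH]; first by rewrite big_geq// sub0n div0n.
rewrite big_nat_recr//= IH indicE mem_arith_prog_setS// -natrD; congr _%:R.
case: leqP => bn /=; last first.
  by rewrite addn0; congr (_ %/ _)%N; lia.
by rewrite subSn// divnS// addnC.
Qed.

Lemma arith_prog_discrepancy {R : realType} (a b : nat) : (0 < a)%N ->
  forall n, `|\sum_(1 <= k < n.+1) (a%:R * \1_(arith_prog_set a b) k - 1)|
    <= (a + b)%:R :> R.
Proof.
move=> a0 n; rewrite sumrB -mulr_sumr arith_prog_count// sumr_const_nat subn1/=.
rewrite -natrM distrC ger0_norm ?subr_ge0 ?ler_nat; last first.
  by rewrite mulnC (leq_trans (leq_divM _ _))// leq_subr.
rewrite lerBlDr -natrD ler_nat.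
have := divn_eq (n - b) a; have := ltn_pmod (n - b) a0.
move: (_ %/ _)%N (_ %% _)%N => q m; nia.
Qed.

(** * The derivative compared with the increments of the function *)

(** The difference quotients of [f] at [x] in the direction [y - x] are at most
    [f y - f x] for steps h in (0, 1], and they tend to
    [derive1 f x * (y - x)] as h decreases to 0.  Working with this directional
    derivative treats the two signs of [y - x] at once. *)
Lemma convex_tangent_le {R : realType} {D : set R^o} {f : R -> R} {x y : R} :
  convex_function D f -> x \in D -> y \in D -> derivable f x 1 ->
  derive1 f x * (y - x) <= f y - f x.
Proof.
move=> fc xD yD fx.
have df : differentiable f x by apply/derivable1_diffP.
have dv : derivable f x (y - x) by apply: diff_derivable.
have -> : derive1 f x * (y - x) = 'D_(y - x) f x.
  by rewrite deriveE// deriv1E// mulrC.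
apply: (cvgr_to_le (cvg_dnbhs_at_right dv)).
near=> h.
have h0 : 0 < h by [].
have h1 : h <= 1 by near: h; apply: nbhs_right_le.
have chord : f (h * y + (1 - h) * x) <= h * f y + (1 - h) * f x :=
  fc (Itv01 (ltW h0) h1) y x yD xD.
rewrite -ler_pdivlMl ?invr_gt0// invrK /= lerBlDr.
have -> : h *: (y - x) + x = h * y + (1 - h) * x.
  by rewrite /GRing.scale/=; ring.
by have -> : h * (f y - f x) + f x = h * f y + (1 - h) * f x by ring.
Unshelve. all: by end_near.
Qed.

Lemma concave_tangent_ge {R : realType} {D : set R^o} {f : R -> R} {x y : R} :
  convex_function D (fun z => - f z) -> x \in D -> y \in D ->
  derivable f x 1 -> f y - f x <= derive1 f x * (y - x).
Proof.
move=> fc xD yD fx; have := convex_tangent_le fc xD yD (derivableN fx).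
by rewrite (derive1N fx); lra.
Qed.

(** A positive increasing function is bounded below, so being unbounded forces
    it to take arbitrarily large values, which it then keeps exceeding. *)
Lemma class_D_cvgy (R : realType) (psi : R -> R) :
  class_D psi -> psi n%:R @[n --> \oo] --> +oo.
Proof.
move=> [psi0 psi_incr _ psi_unb]; apply/cvgryPge => M.
apply: contrapT => small; apply: psi_unb.
exists M; split; first exact: num_real.
move=> B MB x /= x0; rewrite ger0_norm; last exact/ltW/psi0.
apply: contrapT => /negP; rewrite -ltNge => Bx; apply: small.
have x0' : 0 < x by rewrite in_itv/= andbT in x0.
near=> n.
have xn : x < n%:R by near: n; exact: nbhs_infty_gtr.
apply: (le_trans (ltW MB)); apply: (le_trans (ltW Bx)); apply/ltW/psi_incr => //.
by rewrite in_itv/= andbT (lt_trans x0').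
Unshelve. all: by end_near.
Qed.

Lemma class_D_derive1_ge0 {R : realType} {psi : R -> R} (k : nat) :
  class_D psi -> (0 < k)%N -> 0 <= derive1 psi k%:R.
Proof.
move=> [_ psi_incr psi_der _] k0.
apply: (incr_derive1_ge0_itvy _ psi_incr); last by rewrite in_itv/= andbT ltr0n.
by move=> x; rewrite inE; exact: psi_der.
Qed.

(** * Densities with respect to a function of class D *)

(** Eventually P 1 <= P n / 2, so that P n <= 2 W n for the sums W of [w];
    hence W inherits from [P] both properties. *)
Lemma weight_sum_asymptotics (R : realType) (w P : nat -> R) :
  (forall n, (0 < n)%N -> P n - P 1%N <= \sum_(1 <= k < n.+1) w k) ->
  (forall k, (0 < k)%N -> 0 <= w k) ->
  P n @[n --> \oo] --> +oo ->
  w n / P n @[n --> \oo] --> (0 : R) ->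
  \sum_(1 <= k < n.+1) w k @[n --> \oo] --> +oo /\
  w n / \sum_(1 <= k < n.+1) w k @[n --> \oo] --> (0 : R).
Proof.
move=> PW w0 Poo wP.
have P1 : \forall n \near \oo, 1 + 2 * `|P 1%N| <= P n.
  by move/cvgryPge : Poo; apply.
have half : \forall n \near \oo, P n / 2 <= \sum_(1 <= k < n.+1) w k.
  near=> n.
  have n0 : (0 < n)%N by near: n; exact: nbhs_infty_gt.
  have := PW n n0; have : 1 + 2 * `|P 1%N| <= P n by near: n.
  have := ler_norm (P 1%N); lra.
split.
  apply/cvgryPge => A; near=> n.
  have PA : 2 * A <= P n by near: n; move/cvgryPge : Poo; apply.
  have PWn : P n / 2 <= \sum_(1 <= k < n.+1) w k by near: n.
  lra.
apply: (@squeeze_cvgr _ _ _ _ (fun=> 0) (fun n => 2 * (w n / P n))).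
- near=> n.
  have n0 : (0 < n)%N by near: n; exact: nbhs_infty_gt.
  have P0 : 0 < P n.
    apply: (@lt_le_trans _ _ (1 + 2 * `|P 1%N|)); last by near: n.
    by have := normr_ge0 (P 1%N); lra.
  have PWn : P n / 2 <= \sum_(1 <= k < n.+1) w k by near: n.
  have W0 : 0 < \sum_(1 <= k < n.+1) w k by apply: lt_le_trans PWn; lra.
  rewrite divr_ge0 ?w0 ?(ltW W0)//= ler_pdivrMr//.
  have wn := w0 n n0.
  have wP0 : 0 <= w n / P n by rewrite divr_ge0// ltW.
  have -> : 2 * (w n / P n) * \sum_(1 <= k < n.+1) w k =
    w n / P n * (2 * \sum_(1 <= k < n.+1) w k) by ring.
  rewrite -[leLHS](@divfK _ (P n)) ?gt_eqF// ler_wpM2l//; lra.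
- exact: cvg_cst.
- by rewrite -[X in _ --> X](mulr0 2); apply: cvgMl_tmp.
Unshelve. all: by end_near.
Qed.

(** What the concave and the convex case have to provide. *)
Lemma psi_density_arith_prog {R : realType} {a b : nat} {psi : R -> R} :
  (0 < a)%N -> class_D psi ->
  monotone_pos (fun k => derive1 psi k%:R) ->
  (forall n, (0 < n)%N ->
    psi n%:R - psi 1 <= \sum_(1 <= k < n.+1) derive1 psi k%:R) ->
  derive1 psi n%:R / psi n%:R @[n --> \oo] --> (0 : R) ->
  has_psi_density psi (arith_prog_set a b) a%:R^-1.
Proof.
move=> a0 psiD wm PW wP.
have w0 k := class_D_derive1_ge0 k psiD.
have [Woo wW] := weight_sum_asymptotics _ _ _ PW w0 (class_D_cvgy _ _ psiD) wP.
apply: weighted_density_of_bounded_discrepancy => //; first by rewrite ltr0n.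
exact: arith_prog_discrepancy.
Qed.

Lemma psi_gt0_near {R : realType} {psi : R -> R} :
  class_D psi -> \forall n \near \oo, 0 < psi n%:R.
Proof.
move=> [psi0 _ _ _]; near=> n; apply/psi0; rewrite in_itv/= andbT ltr0n.
by near: n; exact: nbhs_infty_gt.
Unshelve. all: by end_near.
Qed.

Lemma concave_psi_density {R : realType} {a b : nat} {psi : R -> R} :
  (0 < a)%N -> class_D1 psi ->
  has_psi_density psi (arith_prog_set a b) a%:R^-1.
Proof.
move=> a0 [psiD conc]; have [_ _ psi_der _] := psiD.
have w0 k := class_D_derive1_ge0 k psiD.
have psi_gt0 := psi_gt0_near psiD.
have tg x y (x0 : 0 < x) (y0 : 0 < y) :
    psi y - psi x <= derive1 psi x * (y - x).
  by apply: (concave_tangent_ge conc);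
    rewrite ?inE /= ?in_itv/= ?x0 ?y0//; apply: psi_der; rewrite in_itv/= x0.
have incr k : (0 < k)%N -> psi k.+1%:R - psi k%:R <= derive1 psi k%:R.
  move=> k0; have := tg k%:R k.+1%:R; rewrite !ltr0n => /(_ k0 isT).
  by rewrite -natrB// subSnn mulr1.
have wm k : (0 < k)%N -> derive1 psi k.+1%:R <= derive1 psi k%:R.
  move=> k0; have := tg k.+1%:R k%:R; rewrite !ltr0n => /(_ isT k0).
  by have := incr k k0; rewrite -natr1; lra.
have w1 n : (0 < n)%N -> derive1 psi n%:R <= derive1 psi 1.
  by elim: n => // -[//|n] IH _; rewrite (le_trans (wm _ _))// IH.
apply: psi_density_arith_prog => //; first by right.
  move=> n n0; rewrite -(telescope_sumr (fun k => psi k%:R) n0).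
  rewrite big_nat_recr//=.
  apply: (@le_trans _ _ (\sum_(1 <= k < n) derive1 psi k%:R)).
    by apply: ler_sum_nat => k /andP[k0 _]; exact: incr.
  by rewrite lerDl w0.
apply: (@squeeze_cvgr _ _ _ _ (fun=> 0)
  (fun n => derive1 psi 1 * (psi n%:R)^-1)).
- near=> n.
  have n0 : (0 < n)%N by near: n; exact: nbhs_infty_gt.
  have psin : 0 < psi n%:R by near: n.
  by rewrite divr_ge0 ?w0 ?(ltW psin)//= ler_pM2r ?invr_gt0// w1.
- exact: cvg_cst.
- rewrite -[X in _ --> X](mulr0 (derive1 psi 1)); apply: cvgMl_tmp.
  by apply/gtr0_cvgV0 => //; exact: class_D_cvgy.
Unshelve. all: by end_near.
Qed.

Lemma convex_psi_density {R : realType} {a b : nat} {psi : R -> R} :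
  (0 < a)%N -> class_D psi ->
  convex_function (`]0, +oo[%classic : set R^o) psi ->
  derive1 psi (arith_prog a b n)%:R / psi n%:R @[n --> \oo] --> (0 : R) ->
  has_psi_density psi (arith_prog_set a b) a%:R^-1.
Proof.
move=> a0 psiD conv lim0; have [_ _ psi_der _] := psiD.
have w0 k := class_D_derive1_ge0 k psiD.
have psi_gt0 := psi_gt0_near psiD.
have tg x y (x0 : 0 < x) (y0 : 0 < y) :
    derive1 psi x * (y - x) <= psi y - psi x.
  by apply: (convex_tangent_le conv);
    rewrite ?inE /= ?in_itv/= ?x0 ?y0//; apply: psi_der; rewrite in_itv/= x0.
have incr k : (0 < k)%N -> psi k.+1%:R - psi k%:R <= derive1 psi k.+1%:R.
  move=> k0; have := tg k.+1%:R k%:R; rewrite !ltr0n => /(_ isT k0).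
  by rewrite -natr1; lra.
have wle (x y : R) : 0 < x -> x <= y -> derive1 psi x <= derive1 psi y.
  move=> x0; rewrite le_eqVlt => /predU1P[->//|xy].
  have y0 := lt_trans x0 xy.
  have := le_trans (tg x y x0 y0) (_ : _ <= derive1 psi y * (y - x)).
  rewrite ler_pM2r ?subr_gt0//; apply.
  by have := tg y x y0 x0; lra.
apply: psi_density_arith_prog => //.
- by left => k k0; rewrite wle ?ltr0n// ler_nat.
- move=> n n0; rewrite -(telescope_sumr (fun k => psi k%:R) n0).
  rewrite big_nat_recl//= -[leLHS]add0r lerD ?w0//.
  by apply: ler_sum_nat => k /andP[k0 _]; exact: incr.
apply: (squeeze_cvgr _ (cvg_cst 0) lim0).
near=> n.
have n0 : (0 < n)%N by near: n; exact: nbhs_infty_gt.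
have psin : 0 < psi n%:R by near: n.
rewrite divr_ge0 ?w0 ?(ltW psin)//= ler_pM2r ?invr_gt0// wle ?ltr0n//.
by rewrite ler_nat /arith_prog; nia.
Unshelve. all: by end_near.
Qed.

Theorem theorem4p1 (R : realType) (a b : nat) (psi : R -> R) :
  (0 < a)%N ->
  class_D1 psi \/
  (class_D2 psi /\
   derive1 psi (arith_prog a b n)%:R / psi n%:R @[n --> \oo] --> (0 : R)) ->
  has_psi_density psi (arith_prog_set a b) (1 / a%:R).
Proof.
rewrite div1r => a0 [psiD1|[[psiD conv _] lim0]].
- exact: concave_psi_density.
- exact: convex_psi_density.
Qed.
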